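(* For any integers $n$ and $k$ with $0\le k\le n-1$, there exists a weak cycle $D$ on $n$ vertices such that $F(D)=k$.
   Context: A finite simple digraph $D=(V,A)$ has finite nonempty vertex set $V$ and arc set $A$ consisting of ordered pairs of distinct vertices (no loops, no parallel arcs; both $(u,v)$ and $(v,u)$ may be present). $N_D^+(v)=\{u:(v,u)\in A\}$. A weak cycle is a digraph whose underlying simple undirected graph (replace each arc $(u,v)$ by the edge $\{u,v\}$) is a cycle; by convention the single vertex $K_1$ and any digraph whose underlying graph is $K_2$ are also included as weak cycles. Zero forcing: for $S\subseteq V$ let $B^0(S)=S$ and $B^{i+1}(S)=B^i(S)\cup\{w:\{w\}=N_D^+(v)\setminus B^i(S)\text{ for some }v\in B^i(S)\}$. $S$ is a zero forcing set (ZFS) if $B^t(S)=V$ for some $t\ge 0$, and a failed zero forcing set (FZFS) otherwise. The failed zero forcing number $F(D)$ is the largest cardinality of an FZFS of $D$. *)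

(* Defs.v *)
From mathcomp Require Import all_boot all_order all_algebra.

Set Implicit Arguments.
Unset Strict Implicit.
Unset Printing Implicit Defensive.

Record digraph := Digraph {
  vertex :> finType;
  arc : rel vertex;
  arc_irrefl : irreflexive arc;
  vertex_gt0 : 0 < #|vertex|
}.

Definition out_neighbours (D : digraph) (v : D) : {set D} := [set u | arc v u].

Definition underlying (D : digraph) : rel D := fun u v => arc u v || arc v u.

Definition cycle_graph (m : nat) : rel 'I_m :=
  fun i j => (j == ordS i) || (i == ordS j).

(* The bound 3 <= m is needed: cycle_graph 1 has a loop and cycle_graph 2 is
   K_2. *)
Definition is_cycle (T : finType) (e : rel T) : Prop :=
  exists2 m : nat, 3 <= m &
    exists2 f : 'I_m -> T, bijective f &
      forall i j, e (f i) (f j) = cycle_graph i j.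

Definition is_complete (T : finType) (e : rel T) (m : nat) : Prop :=
  #|T| = m /\ forall u v, e u v = (u != v).

Definition weak_cycle (D : digraph) : Prop :=
  [\/ is_cycle (@underlying D),
      is_complete (@underlying D) 1
    | is_complete (@underlying D) 2].

Definition force_step (D : digraph) (B : {set D}) : {set D} :=
  B :|: [set w | [exists v in B, [set w] == out_neighbours v :\: B]].

Definition forced (D : digraph) (S : {set D}) (i : nat) : {set D} :=
  iter i (@force_step D) S.

Definition zero_forcing (D : digraph) (S : {set D}) : Prop :=
  exists t, forced S t = [set: D].

(* Decision procedure for zero_forcing: the process is stationary after at most
   #|D| steps, see zero_forcingP. *)
Definition zero_forcingb (D : digraph) (S : {set D}) : bool :=
  forced S #|D| == [set: D].

Lemma forced_sub (D : digraph) (S : {set D}) i j :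
  i <= j -> forced S i \subset forced S j.
Proof.
move=> /subnKC <-; elim: (j - i) => [|k IHk]; first by rewrite addn0.
by rewrite addnS (subset_trans IHk) //= subsetUl.
Qed.

Lemma forced_stationary (D : digraph) (S : {set D}) i j :
  forced S i.+1 = forced S i -> i <= j -> forced S j = forced S i.
Proof.
move=> fix_i /subnKC <-; elim: (j - i) => [|k IHk]; first by rewrite addn0.
by rewrite addnS [LHS]/= -/(forced S _) IHk.
Qed.

Lemma zero_forcingP (D : digraph) (S : {set D}) :
  reflect (zero_forcing S) (zero_forcingb S).
Proof.
apply: (iffP eqP) => [fS | [t ft]]; first by exists #|D|.
have grow i : i <= #|forced S i| \/ forced S i.+1 = forced S i.
  elim: i => [|i [le_i | fix_i]]; first by left.
    have [eq_i | neq_i] := eqVneq (forced S i) (forced S i.+1).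
      by right; apply: (congr1 (@force_step D) (esym eq_i)).
    left; apply: leq_ltn_trans le_i (proper_card _).
    by rewrite properEneq neq_i forced_sub.
  by right; apply: (congr1 (@force_step D) fix_i).
have [full | fixD] := grow #|D|.
  by apply/eqP; rewrite eqEcard subsetT cardsT.
apply/eqP; rewrite -subTset -ft.
have [le_t | /ltnW le_D] := leqP t #|D|; first exact: forced_sub.
by rewrite (forced_stationary fixD le_D).
Qed.

Definition failed_zero_forcing (D : digraph) (S : {set D}) : Prop :=
  ~ zero_forcing S.

Definition failed_number (D : digraph) : nat :=
  \max_(S : {set D} | ~~ zero_forcingb S) #|S|.

(* A failed zero forcing set always exists, so that the maximum in failed_number
   is not over an empty range. *)
Lemma failed_set0 (D : digraph) : failed_zero_forcing (set0 : {set D}).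
Proof.
case=> t; suff -> : forced (set0 : {set D}) t = set0.
  by move/esym/(congr1 (fun A : {set D} => #|A|)); rewrite cardsT cards0
    => card0; have := vertex_gt0 D; rewrite card0.
elim: t => //= t ->; rewrite /force_step set0U; apply/setP=> w.
by rewrite !inE; apply/existsP=> -[v]; rewrite inE.
Qed.

Lemma failed_number_spec (D : digraph) :
  (exists2 S : {set D}, failed_zero_forcing S & #|S| = failed_number D) /\
  (forall S : {set D}, failed_zero_forcing S -> #|S| <= failed_number D).
Proof.
split=> [|S /zero_forcingP fS]; last exact: leq_bigmax_cond.
have /zero_forcingP f0 := @failed_set0 D.
have [|S /zero_forcingP fS eqS] :=
  @eq_bigmax_cond _ [pred S : {set D} | ~~ zero_forcingb S] (fun S => #|S|).
  by apply/card_gt0P; exists set0.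
by exists S.
Qed.

(* Main.v *)
Require Import Defs.
From mathcomp Require Import all_boot all_order all_algebra.
From mathcomp Require Import zify.

(** The complements of the maximal failed sets are the minimal forts: nonempty
    sets [W] such that no vertex outside [W] has exactly one out-neighbour in
    [W].  Hence [F(D) = n - m], with [m] the least size of a fort.  Take a
    bidirected path [0 <-> 1 <-> ... <-> 2a], followed by a directed path
    [2a -> 2a+1 -> ... -> n-1].  A fort meets every pair of consecutive vertices
    of [0 .. 2a].  If the cycle is closed by [n-1 -> 0], a fort moreover contains
    [0] and all of [2a+1 .. n-1], so [m = n - a] and [F(D) = a].  If it is closed
    by [0 -> n-1] instead, the even vertices of [0 .. 2a] are a least fort, so
    [m = a + 1] and [F(D) = n - 1 - a].  These cover [k < n/2] and [k >= n/2]. *)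

(** * Forts and failed zero forcing sets *)

Definition fort {D : digraph} (W : {set D}) : Prop :=
  W != set0 /\
  forall v w : D, v \notin W -> w \in W -> Defs.arc v w ->
    exists w' : D, [/\ w' \in W, w' != w & Defs.arc v w'].

(** A vertex outside a fort that sees one of its vertices sees a second one, so it forces nothing:
    the complement is stationary. *)
Lemma fort_failed (D : digraph) (W : {set D}) :
  fort W -> failed_zero_forcing (~: W).
Proof.
case=> W0 fW [t].
have stat : force_step (~: W) = ~: W.
  apply/setUidPl/subsetP=> w; rewrite !inE => /existsP[v].
  rewrite inE => /andP[vW /eqP eqw]; apply/negP=> wW.
  have: w \in [set w] by rewrite set11.
  rewrite eqw !inE negbK => /andP[_ avw].
  have [w' [w'W neq avw']] := fW v w vW wW avw.
  have: w' \in out_neighbours v :\: ~: W by rewrite !inE negbK w'W.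
  by rewrite -eqw inE (negPf neq).
have -> : forced (~: W) t = ~: W by elim: t => //= t ->.
by move/(congr1 (@setC D)); rewrite setCK setCT => WE; rewrite WE eqxx in W0.
Qed.

(** If [w] were the only out-neighbour of [v] outside [S], then [v] would force [w]. *)
Lemma stationary_fort (D : digraph) (S : {set D}) :
  force_step S = S -> S != setT -> fort (~: S).
Proof.
move=> stat ST; split=> [|v w].
  by apply: contra ST => /eqP/(congr1 (@setC D)); rewrite setCK setC0 => ->.
rewrite !inE negbK => vS wS avw.
have [/existsP[w' /and3P[]] | none] :=
  boolP [exists w', [&& w' \notin S, w' != w & Defs.arc v w']].
  by exists w'; rewrite inE.
case/negP: (wS); rewrite -stat !inE; apply/orP; right.
apply/existsP; exists v; rewrite vS /=; apply/eqP/setP=> x; rewrite !inE.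
apply/eqP/andP=> [-> // | [xS avx]].
by apply/eqP; apply: contraR none => neq; apply/existsP; exists x; rewrite xS neq.
Qed.

(** A failed set of maximum size is stationary, because one forcing step keeps it failed and so
    cannot enlarge it. Its complement is therefore a fort. *)
Lemma failed_number_fort (D : digraph) (m : nat) :
  (exists2 W : {set D}, fort W & #|W| = m) ->
  (forall W : {set D}, fort W -> m <= #|W|) ->
  failed_number D = #|D| - m.
Proof.
case=> W /fort_failed fW <- minW.
have [[S fS cS] maxS] := failed_number_spec D.
apply/eqP; rewrite eqn_leq; apply/andP; split; last first.
  by have := maxS _ fW; rewrite cardsCs setCK.
have stat : force_step S = S.
  apply/esym/eqP; rewrite eqEcard subsetUl cS maxS // => -[t ft].
  by apply: fS; exists t.+1; rewrite /forced iterSr.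
have ST : S != setT by apply/eqP=> SE; apply: fS; exists 0.
have := minW _ (stationary_fort _ _ stat ST).
by rewrite -cS (cardsCs S); have := max_card (~: S); lia.
Qed.

(** * The two families of weak cycles *)

Definition cyc_arc (n a : nat) (b : bool) (i j : nat) : bool :=
  (i != j) &&
  [|| j == i.+1, (i == j.+1) && (i <= a.*2)
    | if b then (i.+1 == n) && (j == 0) else (i == 0) && (j.+1 == n)].

(** The guard [i != j] in [cyc_arc] matters on a single vertex, where the closing arc would be a
    loop. *)
Lemma cyc_arc_irrefl N a b :
  irreflexive (fun i j : 'I_N.+1 => cyc_arc N.+1 a b i j).
Proof. by move=> i; rewrite /cyc_arc eqxx. Qed.

Lemma ord_gt0 N : 0 < #|'I_N.+1|. Proof. by rewrite card_ord. Qed.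

Definition cyc_digraph (N a : nat) (b : bool) : digraph :=
  @Digraph 'I_N.+1 _ (cyc_arc_irrefl N a b) (ord_gt0 N).

Lemma cyc_digraph_weak_cycle N a b : weak_cycle (cyc_digraph N a b).
Proof.
have [N0|N1|N2] : [\/ N = 0, N = 1 | 2 <= N].
- by case: N => [|[|N]]; constructor.
- apply: Or32; subst N; split=> [|u v]; first by rewrite card_ord.
  by rewrite [u]ord1 [v]ord1 /underlying /= /cyc_arc.
- apply: Or33; subst N; split=> [|u v]; first by rewrite card_ord.
  rewrite /underlying /= /cyc_arc -val_eqE /=.
  by case: u => [[|[|u]] ltu]; case: v => [[|[|v]] ltv] //=; rewrite ?andbF ?orbT.
apply: Or31; exists N.+1 => //; exists id; first by exists id.
move=> i j; rewrite /underlying /= /cyc_arc /cycle_graph -!val_eqE /=.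
have ltS (k : 'I_N.+1) : k.+1 %% N.+1 = if k.+1 == N.+1 then 0 else k.+1.
  case: eqP => [->|neq]; first by rewrite modnn.
  by rewrite modn_small //; have := ltn_ord k; lia.
rewrite !ltS; have := ltn_ord i; have := ltn_ord j.
case: i j => [i lti] [j ltj] /= _ _; clear ltS.
by case: b; case: (eqVneq i.+1 N.+1); case: (eqVneq j.+1 N.+1); lia.
Qed.

Lemma card_ord_sum N (W : {set 'I_N.+1}) :
  #|W| = \sum_(0 <= i < N.+1) (inord i \in W : nat).
Proof.
rewrite big_mkord -sum1_card big_mkcond /=.
by apply: eq_bigr => i _; rewrite inord_val; case: (i \in W).
Qed.

(** * Lower bounds on the size of a fort *)

Section Forts.

Variables (N a : nat) (b : bool).
Hypothesis aN : a.*2 < N.+1.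

(** Forts as predicates on natural numbers, so that indices can be shifted without ordinal casts. *)
Definition nat_fort (w : nat -> bool) : Prop :=
  (exists2 i, i <= N & w i) /\
  forall i j, i <= N -> j <= N -> ~~ w i -> w j -> cyc_arc N.+1 a b i j ->
    exists j', [/\ j' <= N, w j', j' != j & cyc_arc N.+1 a b i j'].

Lemma fort_nat_fort (W : {set cyc_digraph N a b}) :
  fort W -> nat_fort (fun i => (inord i : 'I_N.+1) \in W).
Proof.
case=> /set0Pn[x xW] fW; split.
  by exists (x : 'I_N.+1); rewrite ?inord_val // -ltnS ltn_ord.
move=> i j leiN lejN wi wj aij.
have := fW (inord i : 'I_N.+1) (inord j : 'I_N.+1) wi wj.
rewrite /= !inordK // => /(_ aij) [j' [wj' neq aij']].
exists (j' : 'I_N.+1); split=> //; rewrite ?inord_val //.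
  by rewrite -ltnS ltn_ord.
by move: neq; rewrite -val_eqE /= inordK.
Qed.

Lemma nat_fort_fort (w : nat -> bool) :
  nat_fort w -> fort ([set i : 'I_N.+1 | w i] : {set cyc_digraph N a b}).
Proof.
case=> -[i leiN wi] fw; split.
  by apply/set0Pn; exists (inord i : 'I_N.+1); rewrite inE inordK.
move=> u v; rewrite !inE => wu wv auv.
have [|| j [lejN wj neq auj]] := fw u v _ _ wu wv auv.
- by rewrite -ltnS ltn_ord.
- by rewrite -ltnS ltn_ord.
by exists (inord j : 'I_N.+1); rewrite inE /= -val_eqE /= !inordK.
Qed.

Section LowerBound.

Variable w : nat -> bool.
Hypothesis fw : nat_fort w.

Lemma fort_unique i j : i <= N -> j <= N -> cyc_arc N.+1 a b i j ->
  (forall j', j' <= N -> cyc_arc N.+1 a b i j' -> w j' -> j' = j) ->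
  w j -> w i.
Proof.
move=> leiN lejN aij uniq wj; apply: contraT => wi.
have [j' [lej'N wj' /eqP neq aij']] := fw.2 i j leiN lejN wi wj aij.
by case: neq; apply: uniq.
Qed.

(** The closing arc does not leave [i.+1], whose only out-neighbour other than [i.+2] can be [i]. *)
Lemma fort_forward i : i.+2 <= N -> ~~ w i -> ~~ w i.+1 -> ~~ w i.+2.
Proof.
move=> lei wi; apply: contra; apply: fort_unique; rewrite ?(ltnW lei) //.
  by rewrite /cyc_arc; lia.
move=> j lejN; rewrite /cyc_arc; have [-> | neq] := eqVneq j i.
  by rewrite (negPf wi).
by case: b; lia.
Qed.

Lemma fort_backward i : i.+1 < a.*2 -> ~~ w i.+1 -> ~~ w i.+2 -> ~~ w i.
Proof.
move=> lei wi1 wi2; apply: contra wi1; apply: fort_unique; try lia.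
  by rewrite /cyc_arc; lia.
move=> j lejN; rewrite /cyc_arc; have [-> | neq] := eqVneq j i.+2.
  by rewrite (negPf wi2).
by case: b; lia.
Qed.

(** A gap at 0 and 1 would spread forward along the whole path and leave the fort empty. *)
Lemma fort_start : w 0 || (0 < N) && w 1.
Proof.
apply: contraT; rewrite negb_or negb_and => /andP[w0 w1].
have [[i leiN wi] _] := fw.
suff all0 k : (k <= N -> ~~ w k) /\ (k.+1 <= N -> ~~ w k.+1).
  by have := (all0 i).1 leiN; rewrite wi.
elim: k => [|k [IH0 IH1]]; first by split=> // N0; move: w1; rewrite N0.
by split=> // lek; apply: fort_forward => //; [apply: IH0|apply: IH1]; lia.
Qed.

(** A later gap of two vertices would move back by one, against the induction hypothesis. *)
Lemma fort_consecutive i : i < a.*2 -> w i || w i.+1.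
Proof.
elim: i => [|i IH] lti; first by have := fort_start; case: (w 0) => //= /andP[].
apply: contraT; rewrite negb_or => /andP[w1 w2].
have := IH (ltnW lti); rewrite (negPf w1) orbF => wi.
by have := fort_backward _ lti w1 w2; rewrite wi.
Qed.

(** The [a] disjoint pairs [2c+1, 2c+2] are each met; vertex 0 is left to be counted separately. *)
Lemma fort_pairs : a <= \sum_(1 <= i < a.*2.+1) (w i : nat).
Proof.
suff H c : c <= a -> c <= \sum_(1 <= i < c.*2.+1) (w i : nat) by apply: H.
elim: c => // c IH ltc; rewrite doubleS big_nat_recr //= big_nat_recr //=.
have := IH (ltnW ltc); have := fort_consecutive c.*2.+1.
by case: (w c.*2.+1); case: (w c.*2.+2); lia.
Qed.

End LowerBound.

End Forts.

Lemma fort_sum_true N a (w : nat -> bool) : a.*2 < N.+1 ->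
  nat_fort N a true w -> N.+1 - a <= \sum_(0 <= i < N.+1) (w i : nat).
Proof.
move=> aN fw.
have w0 : w 0.
  have /orP[//|/andP[N0]] := fort_start _ _ _ aN _ fw.
  apply: (fort_unique _ _ _ _ fw) => //.
  by move=> j lejN; rewrite /cyc_arc; lia.
(* Each tail vertex has a single out-neighbour, so membership passes back from 0 to [N], then down
   to [2a+1]. *)
have wtail i : a.*2 < i -> i <= N -> w i.
  move=> ltai leiN; rewrite -(subKn leiN).
  have: N - i < N - a.*2 by lia.
  elim: (N - i) => [|k IH] ltk.
    rewrite subn0; apply: (fort_unique _ _ _ _ fw _ 0) => //.
      by rewrite /cyc_arc; lia.
    by rewrite /cyc_arc; lia.
  by apply: (fort_unique _ _ _ _ fw _ (N - k)); rewrite ?/cyc_arc; lia.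
(* Vertex 0 counts 1, the pairs at least [a], and the tail [N - 2a]. *)
rewrite big_ltn // w0.
rewrite (big_cat_nat (n := a.*2.+1)) //=.
rewrite [X in _ + (_ + X)](eq_big_nat _ _ (F2 := fun _ => 1)); last first.
  by move=> i /andP[ltai leiN]; rewrite wtail.
rewrite sum_nat_const_nat muln1.
by have := fort_pairs _ _ _ aN _ fw; lia.
Qed.

Lemma fort_sum_false N a (w : nat -> bool) : a.*2 < N ->
  nat_fort N a false w -> a.+1 <= \sum_(0 <= i < N.+1) (w i : nat).
Proof.
move=> aN fw; have aN' : a.*2 < N.+1 by exact: ltnW.
(* The out-neighbours of 0 are 1 and [N]: a fort missing 0 and [N] would contain 1, the only fort
   vertex seen from 0. *)
have wends : w 0 || w N.
  have := fort_start _ _ _ aN' _ fw; apply: contraTT; rewrite negb_or => /andP[w0 wN].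
  rewrite (negPf w0) /=; apply/negP=> /andP[N0 w1]; case/negP: w0; move: w1.
  apply: (fort_unique _ _ _ _ fw) => //.
  move=> j lejN; have [-> | neq] := eqVneq j N; first by rewrite (negPf wN).
  by rewrite /cyc_arc; lia.
rewrite big_nat_recr //= big_ltn; last by lia.
rewrite (big_cat_nat (n := a.*2.+1)) //=.
have := fort_pairs _ _ _ aN' _ fw.
by case/orP: wends => ->; lia.
Qed.

Lemma sum_even c : \sum_(0 <= i < c.*2.+1) (~~ odd i : nat) = c.+1.
Proof.
elim: c => [|c IH]; first by rewrite big_nat1.
by rewrite doubleS 2?big_nat_recr //= IH /= odd_double /=; lia.
Qed.

(** * Least forts and the resulting values of F *)

Lemma failed_number_cyc_true N a : a.*2 < N.+1 ->
  failed_number (cyc_digraph N a true) = a.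
Proof.
move=> aN; rewrite (failed_number_fort _ (N.+1 - a)).
- by rewrite card_ord; lia.
(* Outside this set lie only odd vertices below [2a], and each sees both of its even neighbours. *)
- pose w i := ~~ odd i || (a.*2 < i).
  exists [set i : 'I_N.+1 | w i].
    apply: nat_fort_fort; split; first by exists 0.
    move=> i j leiN lejN; rewrite /w negb_or negbK -leqNgt => /andP[oi lei] wj aij.
    have i0 : 0 < i by case: (i) oi.
    have i2 : i < a.*2.
      by rewrite ltn_neqAle lei andbT; apply: contraTneq oi => ->; rewrite odd_double.
    have oi1 : odd i.-1 = false by move: oi; rewrite -{1}(prednK i0) /=; case: odd.
    have [ej | nj] := eqVneq j i.+1.
      by exists i.-1; rewrite oi1 /cyc_arc; split=> //; lia.
    by exists i.+1; rewrite /= oi eq_sym nj /cyc_arc; split=> //; lia.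
  rewrite card_ord_sum (big_cat_nat (n := a.*2.+1)) //=.
  rewrite (eq_big_nat _ _ (F2 := fun i => ~~ odd i : nat)); last first.
    move=> i /andP[_ lti]; rewrite inE inordK; last by lia.
    by rewrite /w [a.*2 < i]ltnNge -ltnS lti orbF.
  rewrite sum_even (eq_big_nat _ _ (F2 := fun _ => 1)); last first.
    by move=> i /andP[lti ltiN]; rewrite inE inordK // /w lti orbT.
  by rewrite sum_nat_const_nat; lia.
- by move=> W /(fort_nat_fort _ _ _)/fort_sum_true; rewrite card_ord_sum; apply.
Qed.

Lemma failed_number_cyc_false N a : a.*2 < N ->
  failed_number (cyc_digraph N a false) = N - a.
Proof.
move=> aN; rewrite (failed_number_fort _ a.+1).
- by rewrite card_ord subSS.
- pose w i := ~~ odd i && (i <= a.*2).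
  exists [set i : 'I_N.+1 | w i].
    apply: nat_fort_fort; split; first by exists 0.
    move=> i j leiN lejN; rewrite /w => wi /andP[oj lej] aij.
    (* A vertex beyond [2a] has arcs only to larger vertices, hence sees nothing of the fort. *)
    have {wi} [oi lei] : odd i /\ i < a.*2.
      move: wi; rewrite negb_and negbK -ltnNge; move: aij.
      case: (boolP (odd i)) => [oi | ei] /=; last by rewrite /cyc_arc; lia.
      move=> aij _; split=> //; rewrite ltnNge; apply/negP=> lei.
      have : i != a.*2 by apply: contraTneq oi => ->; rewrite odd_double.
      by move: aij; rewrite /cyc_arc; lia.
    have i0 : 0 < i by case: (i) oi.
    have oi1 : odd i.-1 = false by move: oi; rewrite -{1}(prednK i0) /=; case: odd.
    have [ej | nj] := eqVneq j i.+1.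
      by exists i.-1; rewrite oi1 /cyc_arc; split=> //; lia.
    by exists i.+1; rewrite /= oi eq_sym nj /cyc_arc; split=> //; lia.
  rewrite card_ord_sum (big_cat_nat (n := a.*2.+1)) //=; last by lia.
  rewrite (eq_big_nat _ _ (F2 := fun i => ~~ odd i : nat)); last first.
    move=> i /andP[_ lti]; rewrite inE inordK; last by lia.
    by rewrite /w -ltnS lti andbT.
  rewrite sum_even (eq_big_nat _ _ (F2 := fun _ => 0)); last first.
    by move=> i /andP[lti ltiN]; rewrite inE inordK // /w leqNgt lti andbF.
  by rewrite sum_nat_const_nat muln0 addn0.
- by move=> W /(fort_nat_fort _ _ _)/fort_sum_false; rewrite card_ord_sum; apply.
Qed.

Local Open Scope ring_scope.

Theorem theorem4p11 (n k : int) (hkn : 0 <= k <= n - 1) :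
  exists D : digraph,
    [/\ weak_cycle D, #|D|%:Z = n & (failed_number D)%:Z = k].
Proof.
have [N En] : exists N : nat, n = N.+1%:Z by exists `|n - 1|%N; lia.
have [K Ek] : exists K : nat, k = K%:Z by exists `|k|%N; lia.
subst n k; have [small | large] := ltnP K.*2 N.+1.
  exists (cyc_digraph N K true).
  by rewrite card_ord failed_number_cyc_true //; split=> //; apply: cyc_digraph_weak_cycle.
(* Here [N < 2K], so [a = N - K] satisfies [2a < N], and [N - a = K]. *)
exists (cyc_digraph N (N - K) false).
rewrite card_ord failed_number_cyc_false; last by lia.
by split=> //; [apply: cyc_digraph_weak_cycle | lia].
Qed.
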